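(* Let $\mathcal{H}$ be an infinite dimensional complex separable Hilbert space and let $T$ be a bounded linear operator on $\mathcal{H}$. (1) Suppose $T$ is hypercyclic. Then $T$ satisfies property $(UW_E)$ if and only if $E(T)=\emptyset$. (2) Suppose $T$ is supercyclic and $E(T)\subseteq E_0(T^* )$. Then $T$ satisfies property $(UW_E)$ if and only if there is an $\alpha\in\mathbb{C}\setminus\sigma_b(T)$ such that $E(T)\subseteq\{\alpha\}$.
   Context: For a bounded linear operator $T$ on $\mathcal{H}$, $T^*$ is its adjoint, $\sigma(T)$ its spectrum, $\sigma_a(T)$ its approximate point spectrum, $\mathrm{iso}\,\sigma(T)$ the set of isolated points of $\sigma(T)$, $\mathcal{N}(T)$ its kernel and $\mathcal{R}(T)$ its range. $T$ is hypercyclic if there is $x\in\mathcal{H}$ such that $\{T^n x: n=0,1,2,\ldots\}$ is dense in $\mathcal{H}$; $T$ is supercyclic if there is $x\in\mathcal{H}$ such that $\{\lambda T^n x: n=0,1,2,\ldots,\ \lambda\in\mathbb{C}\}$ is dense in $\mathcal{H}$. $T$ is upper semi-Fredholm (resp. lower semi-Fredholm) if $\mathcal{R}(T)$ is closed and $\dim\mathcal{N}(T)<\infty$ (resp. $\operatorname{codim}\mathcal{R}(T)<\infty$); semi-Fredholm if it is upper or lower semi-Fredholm; Fredholm if it is both. The index of a semi-Fredholm operator is $\mathrm{ind}(T)=\dim\mathcal{N}(T)-\operatorname{codim}\mathcal{R}(T)$. The upper semi-Weyl spectrum is $\sigma_{uw}(T)=\{\lambda\in\mathbb{C}: T-\lambda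 I \text{ is not a semi-Fredholm operator with } \mathrm{ind}(T-\lambda I)\le 0\}$. The ascent (resp. descent) of $T$ is the infimum of the $n$ with $\mathcal{N}(T^n)=\mathcal{N}(T^{n+1})$ (resp. $\mathcal{R}(T^n)=\mathcal{R}(T^{n+1})$), or $\infty$ if there is none. $T$ is Browder if it is Fredholm and its ascent and descent are equal and finite; the Browder spectrum is $\sigma_b(T)=\{\lambda\in\mathbb{C}: T-\lambda I\text{ is not Browder}\}$. $E(T)=\{\lambda\in\mathrm{iso}\,\sigma(T): \dim\mathcal{N}(T-\lambda I)>0\}$ and $E_0(T)=\{\lambda\in\mathrm{iso}\,\sigma(T): 0<\dim\mathcal{N}(T-\lambda I)<\infty\}$. $T$ satisfies property $(UW_E)$ if $\sigma_a(T)\setminus\sigma_{uw}(T)=E(T)$. *)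

(* Defs.v *)
From HB Require Import structures.
From mathcomp Require Import all_boot all_order all_algebra.
From mathcomp Require Import all_classical all_reals all_analysis.
From mathcomp Require Export complex.

Set Implicit Arguments.
Unset Strict Implicit.
Unset Printing Implicit Defensive.

Import Order.TTheory GRing.Theory Num.Theory.
Import numFieldNormedType.Exports.

Local Open Scope classical_set_scope.
Local Open Scope ring_scope.

(* Infimum in [0, +oo] of a set of natural numbers; +oo if the set is empty. *)
Definition einf {R : realType} (P : set nat) : \bar R :=
  ereal_inf [set (n%:R)%:E | n in P].

Section Operators.
Context {R : realType} {H : normedModType R[i]}.
Implicit Types (S M : set H) (T : H -> H) (l : R[i]).

(* v_0, ..., v_(n-1) are elements of S whose classes form a basis of S / M. *)
Definition basis_mod S M n (v : 'I_n -> H) :=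
  [/\ forall i, S (v i),
      forall c : 'I_n -> R[i], M (\sum_i c i *: v i) -> forall i, c i = 0 &
      forall x, S x -> exists c : 'I_n -> R[i], M (x - \sum_i c i *: v i)].

Definition edim_mod S M : \bar R :=
  einf [set n | exists v : 'I_n -> H, basis_mod S M v].

Definition edim S : \bar R := edim_mod S [set 0].

Definition ecodim S : \bar R := edim_mod [set: H] S.

Definition kernel T : set H := [set x | T x = 0].

Definition sub_scalar T l : H -> H := fun x => T x - l *: x.

Definition bounded_operator T :=
  exists M : R[i], forall x, `|T x| <= M * `|x|.

Definition invertible T :=
  exists2 S : {linear H -> H}, bounded_operator S & cancel T S /\ cancel S T.

Definition spectrum T : set R[i] := [set l | ~ invertible (sub_scalar T l)].

Definition approx_spectrum T : set R[i] :=
  [set l | exists2 u : nat -> H, forall n, `|u n| = 1 &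
           sub_scalar T l (u n) @[n --> \oo] --> (0 : H)].

(* R[i]^o carries the usual topology of the complex plane. *)
Definition iso_spectrum T : set R[i] := isolated (spectrum T : set R[i]^o).

Definition hypercyclic T := exists x, dense [set iter n T x | n in [set: nat]].

Definition supercyclic T :=
  exists x, dense [set y | exists l n, y = l *: iter n T x].

Definition upper_semi_fredholm T :=
  closed (range T) /\ (edim (kernel T) < +oo)%E.

Definition lower_semi_fredholm T :=
  closed (range T) /\ (ecodim (range T) < +oo)%E.

Definition semi_fredholm T := upper_semi_fredholm T \/ lower_semi_fredholm T.

Definition fredholm T := upper_semi_fredholm T /\ lower_semi_fredholm T.

(* Meaningful for semi-Fredholm T only: there at most one term is infinite. *)
Definition fredholm_index T : \bar R :=
  (edim (kernel T) - ecodim (range T))%E.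

Definition upper_semi_weyl_spectrum T : set R[i] :=
  [set l | ~ (semi_fredholm (sub_scalar T l) /\
              (fredholm_index (sub_scalar T l) <= 0)%E)].

Definition ascent T : \bar R :=
  einf [set n | kernel (iter n T) = kernel (iter n.+1 T)].

Definition descent T : \bar R :=
  einf [set n | range (iter n T) = range (iter n.+1 T)].

Definition browder T :=
  [/\ fredholm T, ascent T = descent T & (ascent T < +oo)%E].

Definition browder_spectrum T : set R[i] := [set l | ~ browder (sub_scalar T l)].

Definition E T : set R[i] :=
  [set l | iso_spectrum T l /\ (0 < edim (kernel (sub_scalar T l)))%E].

Definition E0 T : set R[i] :=
  [set l | iso_spectrum T l /\ (0 < edim (kernel (sub_scalar T l)) < +oo)%E].

Definition property_UWE T :=
  approx_spectrum T `\` upper_semi_weyl_spectrum T = E T.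

(* The z below exists (Riesz) when T is bounded linear and H is complete for
   the norm of dot, and it is unique. *)
Definition adjoint (dot : {dot H for Num.conj}) T : H -> H :=
  fun y => xget 0 [set z | forall x, dot (T x) y = dot x z].

End Operators.

Definition separable_space (X : topologicalType) :=
  exists2 D : set X, countable D & dense D.

(* Main.v *)
(* If [S = T - l] has closed range [M <> H] then [T] acts on [H / M] as [l], so
   the orbit of a vector [x] is [l^n x] modulo [M].  Since [{l^n}] is not dense
   in the plane, this cannot happen for hypercyclic [T]; then any [l] in
   [sigma_a \ sigma_uw] would make [S] bijective, so that this set is empty.
   For supercyclic [T] it forces [H = C x + M] and, on comparing the growth of
   [c l1^n] and [c l2^n], it happens for at most one [l].  Moreover [ker S] is
   not contained in [M]: otherwise [S M] is closed by the open mapping theorem,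
   and [T] acts on the plane [H / S M] as a Jordan block, which is not
   supercyclic.  Hence [H = C e + M] with [S e = 0] and [S M = M].  When [l] is
   in [sigma_a \ sigma_uw], or when [S] is Browder, [ker S] is exactly [C e]; so
   [S] is invertible on [M], [l] is isolated in the spectrum and [S] is Browder
   of index 0. *)

Require Import Defs.
From HB Require Import structures.
From mathcomp Require Import all_boot all_order all_algebra.
From mathcomp Require Import all_classical all_reals all_analysis.
From mathcomp Require Import ring lra.

Set Implicit Arguments.
Unset Strict Implicit.
Unset Printing Implicit Defensive.

Import Order.TTheory GRing.Theory Num.Theory.
Import numFieldNormedType.Exports.

Local Open Scope classical_set_scope.
Local Open Scope ring_scope.

(** * Real-valued norms of vectors and complex numbers *)

Section RealNorm.
Context {R : realType} {V : normedZmodType R[i]}.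
Implicit Types x y z : V.

(* [`|x|] is an element of [R[i]], where the order is only partial. *)
Definition rnorm x : R := complex.Re `|x|.

Lemma rnormE x : `|x| = (rnorm x)%:C%C.
Proof. by rewrite /rnorm RRe_real// normr_real. Qed.

Lemma rnorm_ge0 x : 0 <= rnorm x.
Proof. by rewrite -ler0c -rnormE. Qed.

Lemma rnorm_eq0 x : (rnorm x == 0) = (x == 0).
Proof. by rewrite -[RHS]normr_eq0 rnormE eq_complex /= eqxx andbT. Qed.

Lemma rnorm0 : rnorm (0 : V) = 0.
Proof. by apply/eqP; rewrite rnorm_eq0. Qed.

Lemma rnorm_gt0 x : (0 < rnorm x) = (x != 0).
Proof. by rewrite lt_def rnorm_ge0 andbT rnorm_eq0. Qed.

Lemma rnormD x y : rnorm (x + y) <= rnorm x + rnorm y.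
Proof. by rewrite -lecR rmorphD /= -!rnormE ler_normD. Qed.

Lemma rnormN x : rnorm (- x) = rnorm x.
Proof. by rewrite /rnorm normrN. Qed.

Lemma rdistC x y : rnorm (x - y) = rnorm (y - x).
Proof. by rewrite /rnorm distrC. Qed.

Lemma rdistD z x y : rnorm (x - y) <= rnorm (x - z) + rnorm (z - y).
Proof. by rewrite (le_trans _ (rnormD _ _))// addrA subrK. Qed.

Lemma rnorm_small x : (forall e, 0 < e -> rnorm x <= e) -> x = 0.
Proof.
move=> xe; apply/eqP; rewrite -rnorm_eq0 eq_le rnorm_ge0 andbT.
by apply/ler_addgt0Pr => e e0; rewrite add0r xe.
Qed.

End RealNorm.

Section ComplexNorm.
Context {R : realType}.
Implicit Types a b : R[i].

Lemma rnormZ (V : normedModType R[i]) a (x : V) :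
  rnorm (a *: x) = rnorm a * rnorm x.
Proof. by apply: complexI; rewrite rmorphM /= -!rnormE normrZ. Qed.

Lemma rnormM a b : rnorm (a * b) = rnorm a * rnorm b.
Proof. by apply: complexI; rewrite rmorphM /= -!rnormE normrM. Qed.

Lemma rnorm_nat n : rnorm (n%:R : R[i]) = n%:R :> R.
Proof. by apply: complexI; rewrite -rnormE normr_nat rmorph_nat. Qed.

Lemma rnorm1 : rnorm (1 : R[i]) = 1 :> R.
Proof. exact: (rnorm_nat 1). Qed.

Lemma rnormX a n : rnorm (a ^+ n) = rnorm a ^+ n.
Proof. by apply: complexI; rewrite rmorphXn /= -!rnormE normrX. Qed.

Lemma rnormV a : rnorm a^-1 = (rnorm a)^-1.
Proof. by apply: complexI; rewrite fmorphV /= -!rnormE normfV. Qed.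

Lemma rnorm_real (r : R) : rnorm (r%:C%C) = `|r|.
Proof.
apply: complexI; rewrite -rnormE normc_def /= expr0n /= addr0.
by rewrite sqrtr_sqr.
Qed.

Lemma ler_Re_rnorm a : complex.Re a <= rnorm a.
Proof.
have := normc_ge_Re a; rewrite rnormE lecR.
exact/le_trans/ler_norm.
Qed.

Lemma ler_normIm_rnorm a : `|complex.Im a| <= rnorm a.
Proof.
have := normc_ge_Re (a * 'i%C); rewrite ReiNIm normrN rnormE lecR rnormM.
by rewrite {2}/rnorm normc_def /= expr0n expr1n add0r sqrtr1 mulr1.
Qed.

Lemma ler_normRe_rnorm a : `|complex.Re a| <= rnorm a.
Proof. by have := normc_ge_Re a; rewrite rnormE lecR. Qed.

Lemma rnorm_le_ReIm a : rnorm a <= `|complex.Re a| + `|complex.Im a|.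
Proof.
rewrite {1}(complexE a) (le_trans (rnormD _ _))// rnorm_real rnormM.
by rewrite rnorm_real {1}/rnorm normc_def /= expr0n expr1n add0r sqrtr1 mul1r.
Qed.

End ComplexNorm.

(** * Convergence of sequences whose steps decay geometrically *)

Section Geometric.
Context {R : realType}.

Lemma half_pow_small (c e : R) : 0 < e -> exists n, c * 2^-1 ^+ n <= e.
Proof.
move=> e0.
have /(_ e e0) : forall e, 0 < e ->
    \forall n \near \oo, `|0 - c * 2^-1 ^+ n| < e.
  apply/cvgrPdist_lt; apply: (@cvg_geometric R c 2^-1).
  by rewrite gtr0_norm; lra.
move=> [n _ /(_ n (leqnn n))] /=; rewrite sub0r normrN => /ltW h.
by exists n; apply: le_trans h; exact: ler_norm.
Qed.

(** Completeness with an explicit rate, so that limits enter only through inequalities. The constant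
    4 is the cost of adding the errors of the real and imaginary parts, [2 * c] each. *)
Definition geometric_complete (V : normedZmodType R[i]) :=
  forall (u : nat -> V) (c : R),
  (forall n, rnorm (u n.+1 - u n) <= c * 2^-1 ^+ n) ->
  exists l, forall n, rnorm (u n - l) <= 4 * c * 2^-1 ^+ n.

Lemma geometric_dist (V : normedZmodType R[i]) (u : nat -> V) (c : R) :
  (forall n, rnorm (u n.+1 - u n) <= c * 2^-1 ^+ n) ->
  forall n m, rnorm (u (n + m)%N - u n) <= 2 * c * 2^-1 ^+ n.
Proof.
move=> uc n m.
have c0 : 0 <= c.
  by have := le_trans (rnorm_ge0 _) (uc 0%N); rewrite expr0 mulr1.
(* The sharper bound, with the partial geometric sum, is the one that passes through the induction
   on [m]. *)
suff : rnorm (u (n + m)%N - u n) <= 2 * c * 2^-1 ^+ n * (1 - 2^-1 ^+ m).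
  move=> /le_trans; apply; rewrite ler_piMr//.
  by rewrite !mulr_ge0// exprn_ge0.
elim: m => [|m ih]; first by rewrite addn0 subrr rnorm0 expr0 subrr mulr0.
rewrite addnS (le_trans (rdistD (u (n + m)%N) _ _))//.
have := uc (n + m)%N; rewrite exprD exprS.
by move: (2^-1 ^+ n) (2^-1 ^+ m) ih => a b ih h; nra.
Qed.

(** The intervals with centre [a n] and radius [c * 2^-1 ^+ n] meet pairwise, so the supremum of
    their left ends lies in all of them. *)
Lemma real_geometric_limit (a : nat -> R) c :
  (forall n m, `|a (n + m)%N - a n| <= c * 2^-1 ^+ n) ->
  exists l, forall n, `|a n - l| <= c * 2^-1 ^+ n.
Proof.
move=> ac.
pose A := range (fun n => a n - c * 2^-1 ^+ n).
have ub n : ubound A (a n + c * 2^-1 ^+ n).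
  move=> _ [m _ <-]; have [nm|mn] := leqP n m.
  - have := ac n (m - n)%N; rewrite subnKC// ler_norml => /andP[_ h1].
    (* The shift 0 yields that [c * 2^-1 ^+ m] is nonnegative. *)
    have := ac m 0%N; rewrite addn0 subrr normr0 => h2.
    by move: h1 h2; lra.
  - have := ac m (n - m)%N; rewrite subnKC ?(ltnW mn)// ler_norml.
    move=> /andP[h1 _].
    have := ac n 0%N; rewrite addn0 subrr normr0 => h2.
    by move: h1 h2; lra.
exists (sup A) => n.
have h1 : sup A <= a n + c * 2^-1 ^+ n.
  by apply: ge_sup => //; exists (a 0%N - c * 2^-1 ^+ 0); exists 0%N.
have h2 : a n - c * 2^-1 ^+ n <= sup A.
  by apply: ub_le_sup; [exists (a 0%N + c * 2^-1 ^+ 0); exact: ub|exists n].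
by rewrite ler_norml; lra.
Qed.

Lemma complex_geometric_complete : geometric_complete R[i].
Proof.
move=> u c /geometric_dist uc.
have [n m|p up] := @real_geometric_limit (fun n => complex.Re (u n)) (2 * c).
  by rewrite -raddfB /= (le_trans (ler_normRe_rnorm _)).
have [n m|q uq] := @real_geometric_limit (fun n => complex.Im (u n)) (2 * c).
  by rewrite -raddfB /= (le_trans (ler_normIm_rnorm _)).
exists (p +i* q)%C => n.
rewrite (le_trans (rnorm_le_ReIm _))// !raddfB /=.
by have := up n; have := uq n; lra.
Qed.

Lemma banach_geometric_complete (H : completeNormedModType R[i]) :
  geometric_complete H.
Proof.
move=> u c uc; have ud := geometric_dist uc.
have c0 : 0 <= c.
  by have := le_trans (rnorm_ge0 _) (uc 0%N); rewrite expr0 mulr1.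
have : cvg (u @ \oo).
  apply: cauchy_cvg; apply: cauchy_exP => e.
  rewrite ltcE /= => /andP[/eqP Ime Ree].
  have [n hn] := half_pow_small (2 * c) (divr_gt0 Ree (ltr0n _ 2)).
  exists (u n), n => // m /= nm; rewrite /fmapE -ball_normE /ball_ /=.
  rewrite rnormE ltcE /= Ime eqxx /= rdistC.
  by have := ud n (m - n)%N; rewrite subnKC//; lra.
move=> /cvg_ex[l /cvgrPdist_lt ul]; exists l => n.
apply/ler_addgt0Pr => e e0.
have /ul[N _ uN] : 0 < e%:C%C by rewrite ltcE /= eqxx.
have := uN (n + N)%N (leq_addl _ _); rewrite /= rnormE ltcR => h1.
have h2 := rdistD (u (n + N)%N) (u n) l.
have h3 := ud n N; rewrite rdistC in h3; rewrite rdistC in h1.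
have h4 : 0 <= c * 2^-1 ^+ n by rewrite mulr_ge0// exprn_ge0.
by lra.
Qed.
End Geometric.

(** * The open mapping theorem *)

Section Banach.
Context {R : realType} {H : completeNormedModType R[i]}.
Implicit Types (M D : set H) (S : {linear H -> H}).

Definition linear_subspace M :=
  M 0 /\ forall c x y, M x -> M y -> M (c *: x + y).

(** Closedness phrased with real radii, directly usable in estimates on [rnorm]. *)
Definition nclosed M :=
  forall z, (forall e : R, 0 < e -> exists2 m, M m & rnorm (z - m) <= e) -> M z.

Lemma subspaceZ M c x : linear_subspace M -> M x -> M (c *: x).
Proof. by move=> [M0 MP] Mx; rewrite -[_ *: _]addr0; exact: MP. Qed.

Lemma subspaceD M x y : linear_subspace M -> M x -> M y -> M (x + y).
Proof. by move=> [_ MP] Mx My; rewrite -[x]scale1r; exact: MP. Qed.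

Lemma subspaceN M x : linear_subspace M -> M x -> M (- x).
Proof. by move=> Ms Mx; rewrite -scaleN1r; exact: subspaceZ. Qed.

Lemma subspaceB M x y : linear_subspace M -> M x -> M y -> M (x - y).
Proof. by move=> Ms Mx My; apply: subspaceD => //; exact: subspaceN. Qed.

Lemma subspaceT : linear_subspace [set: H]. Proof. by []. Qed.

Lemma nclosedT : nclosed [set: H]. Proof. by []. Qed.

Lemma subspace_image S D : linear_subspace D -> linear_subspace (S @` D).
Proof.
move=> Ds; split; first by exists 0; [exact: Ds.1|exact: linear0].
move=> c _ _ [x Dx <-] [y Dy <-].
by exists (c *: x + y); [exact: Ds.2|rewrite linearP].
Qed.

Lemma closed_nclosed M : closed M -> nclosed M.
Proof.
move=> Mc z zM; apply: Mc => B /nbhs_ballP[e]; rewrite /= ltcE /=.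
move=> /andP[/eqP Ime Ree] eB; have /zM[m Mm zm] := divr_gt0 Ree (ltr0n _ 2).
exists m; split => //; apply: eB; rewrite -ball_normE /ball_ /=.
by rewrite rnormE ltcE /= Ime eqxx /=; lra.
Qed.

Lemma dense_rnorm D : dense D ->
  forall z e, 0 < e -> exists2 d, D d & rnorm (z - d) < e.
Proof.
move=> Dd z e e0; have ec0 : 0 < e%:C%C by rewrite ltcE /= eqxx.
have [|d [+ Dd']] := Dd (ball z (e%:C%C)) _ (ball_open z (e%:C%C)).
  by exists z; exact: ballxx.
by rewrite -ball_normE /ball_ /= rnormE ltcR; exists d.
Qed.

Definition rbounded S :=
  exists2 K, 0 <= K & forall x, rnorm (S x) <= K * rnorm x.

Lemma bounded_operator_rbounded S : bounded_operator S -> rbounded S.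
Proof.
move=> [K SK]; exists (rnorm K); first exact: rnorm_ge0.
move=> x; rewrite -lecR rmorphM /= -!rnormE.
have -> : `|K| * `|x| = `|K * `|x| | by rewrite normrM normr_id.
have h0 : 0 <= K * `|x| by rewrite (le_trans _ (SK x)).
by rewrite (le_trans (SK x))// ger0_norm.
Qed.

Lemma rbounded_bounded_operator S : rbounded S -> bounded_operator S.
Proof.
move=> [K _ SK]; exists K%:C%C => x.
by rewrite !rnormE -rmorphM /= lecR.
Qed.

(** Correcting the residual again and again halves it each time; the corrections sum to an exact
    solution in [D]. This serves both the open mapping theorem and the surjectivity of perturbed
    operators. *)
Lemma successive_approximation S D M (C : R) : rbounded S ->
  linear_subspace D -> nclosed D -> 0 <= C ->
  (forall v, M v -> exists u, [/\ D u, rnorm u <= C * rnorm v, M (v - S u) &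
                             rnorm (v - S u) <= rnorm v / 2]) ->
  forall v, M v -> exists u, [/\ D u, S u = v & rnorm u <= 4 * C * rnorm v].
Proof.
move=> [K K0 SK] Ds Dc C0 h v Mv.
have {h} /choice[f fP] : forall w, exists u, M w -> [/\ D u,
    rnorm u <= C * rnorm w, M (w - S u) & rnorm (w - S u) <= rnorm w / 2].
  move=> w; have [Mw|nMw] := pselect (M w); last by exists 0.
  by have [u uP] := h w Mw; exists u.
(* [r n] is the residual after [n] corrections and [s n] the sum of these corrections. *)
pose r n := iter n (fun w => w - S (f w)) v.
pose s n := \sum_(k < n) f (r k).
have rM n : M (r n) by elim: n => [//|n /fP[]].
have rv n : rnorm (r n) <= rnorm v * 2^-1 ^+ n.
  elim: n => [|n ih]; first by rewrite expr0 mulr1.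
  have [_ _ _] := fP _ (rM n); rewrite -[_ - _]/(r n.+1) exprS.
  by move: ih; lra.
have sD n : D (s n).
  elim: n => [|n ih]; first by rewrite /s big_ord0; exact: Ds.1.
  by rewrite /s big_ord_recr /=; apply: subspaceD => //; have [] := fP _ (rM n).
have sS n : S (s n) = v - r n.
  elim: n => [|n ih]; first by rewrite /s big_ord0 linear0 subrr.
  have -> : s n.+1 = s n + f (r n) by rewrite /s big_ord_recr.
  have -> : r n.+1 = r n - S (f (r n)) by [].
  by rewrite linearD /= ih opprB [RHS]addrA addrAC.
have [|l sl] := @banach_geometric_complete R H s (C * rnorm v).
  move=> n; rewrite /s big_ord_recr /= addrAC subrr add0r.
  have [_ h _ _] := fP _ (rM n); apply: le_trans h _.
  by rewrite -mulrA ler_wpM2l.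
exists l; split.
- apply: Dc => e e0; have [n hn] := half_pow_small (4 * (C * rnorm v)) e0.
  by exists (s n) => //; rewrite rdistC (le_trans (sl n)).
- apply/eqP; rewrite -subr_eq0; apply/eqP/rnorm_small => e e0.
  have [n hn] := half_pow_small (K * (4 * (C * rnorm v)) + rnorm v) e0.
  apply: le_trans hn; rewrite (le_trans (rdistD (S (s n)) _ _))// mulrDl lerD//.
    rewrite -linearB /= (le_trans (SK _))// -mulrA ler_wpM2l// rdistC.
    exact: sl.
  by rewrite sS addrAC subrr sub0r rnormN.
- have := sl 0%N; rewrite /s big_ord0 sub0r rnormN expr0 mulr1.
  by rewrite mulrA.
Qed.

(** Baire's argument on the closed image: if no bounded piece of [D] had an image dense in some
    relative ball, shrinking balls could avoid the images of all pieces in turn, although their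
    centres converge to some [S u]. *)
Lemma nclosed_image_interior S D : linear_subspace D -> nclosed (S @` D) ->
  exists n y0 (r : R), [/\ 0 < r, (S @` D) y0 & forall y, (S @` D) y ->
    rnorm (y - y0) <= r -> forall e : R, 0 < e ->
    exists u, [/\ D u, rnorm u <= n%:R & rnorm (y - S u) <= e]].
Proof.
move=> Ds Mc; set M := S @` D; apply: contrapT => hn.
(* [p] holds a stage, a centre and a radius; [q] is the next centre and radius, with a margin of
   four radii around the images avoided at that stage. *)
pose P (p : nat * (H * R)) (q : H * R) := M p.2.1 /\ 0 < p.2.2 ->
  [/\ M q.1, rnorm (q.1 - p.2.1) <= p.2.2, 0 < q.2, q.2 <= p.2.2 / 2 &
      forall u, D u -> rnorm u <= p.1%:R -> 4 * q.2 < rnorm (q.1 - S u)].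
have /choice[g gP] : forall p, exists q, P p q.
  move=> [n [y0 r]]; rewrite /P /=.
  have [[My0 r0]|] := pselect (M y0 /\ 0 < r); last by exists (0, 0).
  apply: contrapT => hq; apply: hn; exists n, y0, r; split => // y My yr e e0.
  (* No image of the bounded piece comes within [e] of [y], so the radius [e / 4] secures the
     margin. *)
  apply: contrapT => hu; apply: hq; exists (y, Num.min (r / 2) (e / 4)) => _ /=.
  have m1 : Num.min (r / 2) (e / 4) <= r / 2 by rewrite ge_min lexx.
  have m2 : Num.min (r / 2) (e / 4) <= e / 4 by rewrite ge_min lexx orbT.
  split => //; first by rewrite lt_min; apply/andP; split; lra.
  move=> u Du un; rewrite ltNge; apply/negP => hle; apply: hu; exists u.
  by split => //; lra.
pose st := fix st n := if n is k.+1 then g (k, st k) else (0 : H, 1 : R).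
pose y n := (st n).1; pose r n := (st n).2.
have stP n : M (y n) /\ 0 < r n.
  elim: n => [|n ih]; first by split => //; exact: (subspace_image S Ds).1.
  by have [? ? ? ? ?] := gP (n, st n) ih.
have yr n : rnorm (y n.+1 - y n) <= r n by have [] := gP (n, st n) (stP n).
have rS n : r n.+1 <= r n / 2 by have [] := gP (n, st n) (stP n).
have yS n u : D u -> rnorm u <= n%:R -> 4 * r n.+1 < rnorm (y n.+1 - S u).
  by have [_ _ _ _] := gP (n, st n) (stP n); exact.
have rnm n m : r (n + m)%N <= r n * 2^-1 ^+ m.
  elim: m => [|m ih]; first by rewrite addn0 expr0 mulr1.
  by rewrite addnS exprS; have := rS (n + m)%N; move: ih; lra.
have [|l yl] := @banach_geometric_complete R H y (r 0%N).
  by move=> n; apply: le_trans (yr n) (rnm 0%N n).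
have /Mc [u Du ul] : forall e, 0 < e -> exists2 m, M m & rnorm (l - m) <= e.
  move=> e e0; have [n hn'] := half_pow_small (4 * r 0%N) e0.
  exists (y n); first by have [] := stP n.
  by rewrite rdistC (le_trans (yl n)).
have [n un] : exists n, rnorm u <= n%:R.
  by exists (Num.truncn (rnorm u)).+1; rewrite ltW// truncnS_gt.
have := yS n u Du un; rewrite ul => h1.
have [_ rn0] := stP n.+1.
have [m hm] := half_pow_small (4 * r 0%N) rn0.
have h2 := yl (n.+1 + m)%N.
have h3 : 4 * r 0%N * 2^-1 ^+ (n.+1 + m) <= 4 * r 0%N * 2^-1 ^+ m.
  rewrite ler_wpM2l//; first by rewrite mulr_ge0// ltW//; have [] := stP 0%N.
  rewrite exprD ler_piMl//.
  by rewrite exprn_ile1 ?invr_ge0// invf_le1 ?ler1n.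
(* The later centres stay within [2 * r n.+1] of [y n.+1], and the limit is within a further
   [r n.+1]: in total less than the margin [4 * r n.+1]. *)
have h4 := @geometric_dist R H (fun k => y (n.+1 + k)%N) (r n.+1) _ 0%N m.
have {}h4 : rnorm (y (n.+1 + m)%N - y n.+1) <= 2 * r n.+1.
  move: h4; rewrite expr0 mulr1 addn0 add0n; apply => k.
  by rewrite addnS (le_trans (yr _))// rnm.
have h5 := rdistD (y (n.+1 + m)%N) (y n.+1) l.
rewrite (rdistC (y n.+1) (y _)) in h5.
clear -rn0 h1 h2 h3 hm h4 h5; lra.
Qed.

(** Subtracting approximate preimages of [y0] from those of a nearby point gives approximate
    preimages around 0; rescaling and successive approximation make them exact. *)
Theorem open_mapping S D : rbounded S -> linear_subspace D -> nclosed D ->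
  nclosed (S @` D) ->
  exists2 C, 0 <= C & forall v, (S @` D) v ->
    exists u, [/\ D u, S u = v & rnorm u <= C * rnorm v].
Proof.
move=> Sb Ds Dc Mc; have Ms := subspace_image S Ds.
have [n [y0 [r [r0 My0 h]]]] := nclosed_image_interior Ds Mc.
pose C : R := 2 * n%:R / r.
have C0 : 0 <= C by rewrite divr_ge0 ?mulr_ge0// ltW.
exists (4 * C); first by rewrite mulr_ge0.
apply: successive_approximation => // v Mv.
have [->|v0] := eqVneq v 0.
  exists 0; rewrite linear0 subr0 rnorm0 mulr0 mul0r; split => //.
  - exact: Ds.1.
  - exact: Ms.1.
have nv0 : 0 < rnorm v by rewrite rnorm_gt0.
(* Scaling by [t] brings [v] to norm [r]. The two errors [r / 4] then add up to [r / 2], that is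
   [rnorm v / 2] after scaling back. *)
pose t : R := r / rnorm v; have t0 : 0 < t by rewrite divr_gt0.
have tt0 : t%:C%C != 0 :> R[i] by rewrite eq_complex /= eqxx andbT gt_eqF.
have [|||u1 [Du1 u1n u1e]] := h (t%:C%C *: v + y0) _ _ (r / 4).
- exact: Ms.2.
- by rewrite addrK rnormZ rnorm_real gtr0_norm// /t divfK// gt_eqF.
- by lra.
have [|||u2 [Du2 u2n u2e]] := h y0 _ _ (r / 4) => //.
- by rewrite subrr rnorm0 ltW.
- by lra.
have Du : D (u1 - u2) by exact: subspaceB.
exists ((t%:C%C)^-1 *: (u1 - u2)); split.
- exact: subspaceZ.
- rewrite rnormZ rnormV rnorm_real gtr0_norm// /C /t.
  have hu : rnorm (u1 - u2) <= 2 * n%:R.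
    by have := rnormD u1 (- u2); rewrite rnormN; lra.
  have -> : 2 * n%:R / r * rnorm v = rnorm v / r * (2 * n%:R) by ring.
  by rewrite invf_div ler_wpM2l// divr_ge0 ?ltW.
- by apply: subspaceB => //; exists (t%:C%C^-1 *: (u1 - u2)) => //;
  exact: subspaceZ.
- rewrite linearZ /= linearB /=.
  have -> : v - t%:C%C^-1 *: (S u1 - S u2) =
     t%:C%C^-1 *: ((t%:C%C *: v + y0 - S u1) - (y0 - S u2)).
    rewrite opprB (addrAC _ y0) addrACA subrr addr0 -addrA (addrC (- _)).
    by rewrite -[v in LHS](scalerK tt0) -scalerBr opprB.
  rewrite rnormZ rnormV rnorm_real gtr0_norm// /t.
  have := rnormD (t%:C%C *: v + y0 - S u1) (- (y0 - S u2)).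
  rewrite rnormN invf_div => hu.
  rewrite mulrAC ler_pdivrMr// [leRHS]mulrAC -mulrA ler_wpM2l ?rnorm_ge0//.
  by lra.
Qed.

End Banach.

(** * Orbits modulo an invariant subspace *)

Section SubScalar.
Context {R : realType} {H : normedModType R[i]}.
Variables (T : {linear H -> H}) (l : R[i]).

Lemma sub_scalar_is_linear : linear (sub_scalar T l).
Proof.
move=> c x y; rewrite /sub_scalar linearP scalerDr opprD addrACA scalerBr.
by rewrite !scalerA mulrC.
Qed.

HB.instance Definition _ :=
  GRing.isLinear.Build R[i] H H *:%R (sub_scalar T l) sub_scalar_is_linear.

End SubScalar.

Section Orbits.
Context {R : realType} {H : completeNormedModType R[i]}.
Implicit Types (M : set H) (T : {linear H -> H}).

Lemma rbounded_sub_scalar T l : rbounded T -> rbounded (sub_scalar T l).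
Proof.
move=> [K K0 TK]; exists (K + rnorm l); first by rewrite addr_ge0// rnorm_ge0.
move=> x; rewrite (le_trans (rnormD _ _))// rnormN rnormZ mulrDl lerD2r.
exact: TK.
Qed.

(** [d] is a positive lower bound for the distance from [x] to [M], and homogeneity does the rest.
    The coefficient of [x] modulo [M] is thus bounded, which turns approximation of vectors into
    approximation of scalars. *)
Lemma subspace_gap M x : linear_subspace M -> nclosed M -> ~ M x ->
  exists2 d : R, 0 < d & forall c m, M m -> rnorm c * d <= rnorm (c *: x + m).
Proof.
move=> Ms Mc nMx.
have [d d0 hd] : exists2 d : R, 0 < d & forall m, M m -> d <= rnorm (x - m).
  apply: contrapT => hn; apply: nMx; apply: Mc => e e0.
  apply: contrapT => hm; apply: hn; exists e => // m Mm.
  by rewrite leNgt; apply/negP => /ltW h; apply: hm; exists m.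
exists d => // c m Mm; have [->|c0] := eqVneq c 0.
  by rewrite rnorm0 mul0r rnorm_ge0.
have -> : c *: x + m = c *: (x - - (c^-1 *: m)).
  by rewrite opprK scalerDr scalerA divff// scale1r.
rewrite rnormZ ler_wpM2l ?rnorm_ge0//; apply: hd.
by apply: subspaceN => //; exact: subspaceZ.
Qed.

(** The gap makes the coefficients of [x] in a convergent sequence Cauchy, so they have a limit, and
    [M] absorbs the remainder. *)
Lemma nclosed_add_line M x : linear_subspace M -> nclosed M -> ~ M x ->
  nclosed [set z | exists c, M (z - c *: x)].
Proof.
move=> Ms Mc nMx z zM; have [d d0 hd] := subspace_gap Ms Mc nMx.
have p0 n : 0 < 2^-1 ^+ n :> R by rewrite exprn_gt0.
have /choice[c cP] : forall n, exists c, exists2 m, M m &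
    rnorm (z - (c *: x + m)) <= 2^-1 ^+ n.
  move=> n; have [y [c Mc'] yz] := zM _ (p0 n).
  by exists c, (y - c *: x) => //; rewrite addrCA subrr addr0.
have [|l cl] := @complex_geometric_complete R c (2 / d).
  move=> n; have [m Mm hm] := cP n; have [m' Mm' hm'] := cP n.+1.
  have h := hd (c n.+1 - c n) _ (subspaceB Ms Mm' Mm).
  have h2 : rnorm ((c n.+1 - c n) *: x + (m' - m)) <= 2 * 2^-1 ^+ n.
    rewrite scalerBl addrACA -opprD.
    have := rdistD z (c n.+1 *: x + m') (c n *: x + m).
    rewrite (rdistC _ z) => h3; have := p0 n; rewrite exprS in hm'; lra.
  by rewrite mulrAC ler_pdivlMr//; exact: le_trans h h2.
exists l; apply: Mc => e e0.
have [n hn] := half_pow_small (1 + 4 * (2 / d) * rnorm x) e0.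
have [m Mm hm] := cP n; exists m => //; apply: le_trans hn.
have -> : z - l *: x - m = (z - (c n *: x + m)) + (c n - l) *: x.
  by rewrite scalerBl opprD (addrC (- (c n *: x))) addrA addrA subrK addrAC.
rewrite (le_trans (rnormD _ _))// mulrDl mul1r lerD// rnormZ mulrAC.
by rewrite ler_wpM2r ?rnorm_ge0.
Qed.

Lemma iter_mod M T l x n : linear_subspace M -> (forall z, M (T z - l *: z)) ->
  M (iter n T x - l ^+ n *: x).
Proof.
move=> Ms hM; elim: n => [|n ih].
  by rewrite expr0 scale1r subrr; exact: Ms.1.
set y := iter n T x in ih *.
have -> : iter n.+1 T x - l ^+ n.+1 *: x =
    (T y - l *: y) + l *: (y - l ^+ n *: x).
  by rewrite scalerBr scalerA -exprS addrA subrK.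
by apply: subspaceD => //; exact: subspaceZ.
Qed.

(** Modulo [M], the vector [c *: iter n T x] is [c * l ^+ n] times [x]; approximating [z] therefore
    forces this scalar to approximate [a]. *)
Lemma gap_iter M T l x d z a c n : linear_subspace M ->
  (forall z, M (T z - l *: z)) ->
  (forall c m, M m -> rnorm c * d <= rnorm (c *: x + m)) -> M (z - a *: x) ->
  rnorm (a - c * l ^+ n) * d <= rnorm (z - c *: iter n T x).
Proof.
move=> Ms hM hd Mz.
have -> : z - c *: iter n T x = (a - c * l ^+ n) *: x +
    ((z - a *: x) - c *: (iter n T x - l ^+ n *: x)).
  by rewrite scalerBl scalerBr scalerA opprB addrCA !subrKA.
by apply: hd; apply: subspaceB => //; apply: subspaceZ => //; exact: iter_mod.
Qed.

Lemma hypercyclic_dense_range M T l : hypercyclic T -> linear_subspace M ->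
  nclosed M -> (forall z, M (T z - l *: z)) -> forall z, M z.
Proof.
move=> [x /dense_rnorm xd] Ms Mc hM.
have {xd} xd z e : 0 < e -> exists n, rnorm (z - iter n T x) < e.
  by move=> /(xd z)[_ [n _ <-]]; exists n.
have [Mx z|nMx] := pselect (M x).
  apply: Mc => e /(xd z)[n /ltW zn]; exists (iter n T x) => //.
  rewrite -(subrK (l ^+ n *: x) (iter n T x)); apply: subspaceD => //.
    exact: iter_mod.
  exact: subspaceZ.
have [d d0 hd] := subspace_gap Ms Mc nMx; exfalso.
have key a : exists n, rnorm (a - l ^+ n) <= 2^-1.
  have [|n hn] := xd (a *: x) (2^-1 * d); first by rewrite mulr_gt0.
  exists n; rewrite -(ler_pM2r d0) -[l ^+ n]mul1r.
  have := @gap_iter M T l x d (a *: x) a 1 n Ms hM hd.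
  rewrite subrr scale1r => /(_ Ms.1) h; exact: le_trans h (ltW hn).
(* A power of [l] close to 0 forces [rnorm l <= 1], whereas one close to 2 forces the opposite. *)
have [n] := key 0; rewrite sub0r rnormN rnormX => hn.
have l1 : rnorm l <= 1.
  rewrite leNgt; apply/negP => /ltW l1.
  by have := @exprn_ege1 _ n _ l1; lra.
have [m] := key 2 => hm.
have := rdistD (l ^+ m) (2 : R[i]) 0; rewrite !subr0 rnorm_nat rnormX.
by have := @exprn_ile1 _ m _ (rnorm_ge0 l) l1; lra.
Qed.

Definition supercyclic_vector T x := forall z (e : R), 0 < e ->
  exists c n, rnorm (z - c *: iter n T x) < e.

Lemma supercyclicP T : supercyclic T -> exists x, supercyclic_vector T x.
Proof.
move=> [x /dense_rnorm xd]; exists x => z e /(xd z)[_ [c [n ->]] h].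
by exists c, n.
Qed.

Section Supercyclic.
Variables (T : {linear H -> H}) (x : H).
Hypothesis xT : supercyclic_vector T x.

Lemma supercyclic_vector_notin M l : linear_subspace M -> nclosed M ->
  (forall z, M (T z - l *: z)) -> (exists z, ~ M z) -> ~ M x.
Proof.
move=> Ms Mc hM [z nMz] Mx; apply: nMz; apply: Mc => e /(xT z)[c [n /ltW zn]].
exists (c *: iter n T x) => //; apply: subspaceZ => //.
rewrite -(subrK (l ^+ n *: x) (iter n T x)); apply: subspaceD => //.
  exact: iter_mod.
exact: subspaceZ.
Qed.

(** The multiples of the orbit lie in the span of [x] and [M], which is closed. *)
Lemma supercyclic_codim1 M l : linear_subspace M -> nclosed M ->
  (forall z, M (T z - l *: z)) -> ~ M x -> forall z, exists c, M (z - c *: x).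
Proof.
move=> Ms Mc hM nMx z; apply: (nclosed_add_line Ms Mc nMx) => e.
move=> /(xT z)[c [n /ltW zn]]; exists (c *: iter n T x) => //.
exists (c * l ^+ n); rewrite -scalerA -scalerBr; apply: subspaceZ => //.
exact: iter_mod.
Qed.

(** Some vector is [2 *: x] modulo [M1] and [x] modulo [M2]. Approximating it puts [c * l1 ^+ n]
    near 2 and [c * l2 ^+ n] near 1, against [rnorm l1 <= rnorm l2]. *)
Lemma supercyclic_deficient_unique M1 M2 l1 l2 : l1 != l2 ->
  linear_subspace M1 -> nclosed M1 -> (forall z, M1 (T z - l1 *: z)) ->
  linear_subspace M2 -> nclosed M2 -> (forall z, M2 (T z - l2 *: z)) ->
  ~ M1 x -> ~ M2 x -> False.
Proof.
wlog l12 : M1 M2 l1 l2 / rnorm l1 <= rnorm l2.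
  move=> hw l12 s1 c1 h1 s2 c2 h2 n1 n2.
  have [le12|/ltW le21] := leP (rnorm l1) (rnorm l2).
    exact: (hw M1 M2 l1 l2).
  by apply: (hw M2 M1 l2 l1) => //; rewrite eq_sym.
move=> nl s1 c1 h1 s2 c2 h2 n1 n2.
have [d1 d10 hd1] := subspace_gap s1 c1 n1.
have [d2 d20 hd2] := subspace_gap s2 c2 n2.
have nl' : l2 - l1 != 0 by rewrite subr_eq0 eq_sym.
(* Since [(T w - l1 *: w) - (T w - l2 *: w)] is [(l2 - l1) *: w], this [w] splits [x] between [M1]
   and [M2]. *)
pose w := (l2 - l1)^-1 *: x.
pose m1 := T w - l1 *: w; pose m2 := - (T w - l2 *: w).
have M1m1 : M1 m1 by exact: h1.
have M2m2 : M2 m2 by apply: subspaceN => //; exact: h2.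
have xE : x = m1 + m2.
  rewrite /m1 /m2 opprB addrC subrKA -scalerBl scalerA divff//.
  by rewrite scale1r.
pose e := Num.min d1 d2 / 4.
have e1 : e <= 4^-1 * d1 by rewrite /e mulrC ler_wpM2l// ge_min lexx.
have e2 : e <= 4^-1 * d2 by rewrite /e mulrC ler_wpM2l// ge_min lexx orbT.
have e0 : 0 < e by rewrite divr_gt0// lt_min d10 d20.
have [c [n /ltW hc]] := xT (m1 + 2 *: m2) e0.
have a1 : rnorm (2 - c * l1 ^+ n) <= 4^-1.
  rewrite -(ler_pM2r d10) (le_trans _ e1)// (le_trans _ hc)//.
  apply: (@gap_iter M1) => //; rewrite xE scalerDr opprD addrACA subrr addr0.
  by apply: subspaceB => //; exact: subspaceZ.
have a2 : rnorm (1 - c * l2 ^+ n) <= 4^-1.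
  rewrite -(ler_pM2r d20) (le_trans _ e2)// (le_trans _ hc)//.
  apply: (@gap_iter M2) => //; rewrite xE scale1r opprD addrACA subrr add0r.
  by apply: subspaceB => //; exact: subspaceZ.
have b1 := rdistD (c * l1 ^+ n) (2 : R[i]) 0.
have b2 := rdistD (1 : R[i]) (c * l2 ^+ n) 0.
rewrite !subr0 rnorm_nat in b1; rewrite !subr0 rnorm1 rdistC in b2.
rewrite rnormM rnormX in b1; rewrite rnormM rnormX in b2.
have b3 : rnorm c * rnorm l1 ^+ n <= rnorm c * rnorm l2 ^+ n.
  by rewrite ler_wpM2l ?rnorm_ge0// lerXn2r// nnegrE rnorm_ge0.
by lra.
Qed.

End Supercyclic.
End Orbits.

(** * The kernel of [T - l] against its closed range *)

Section Kernel.
Context {R : realType} {H : completeNormedModType R[i]}.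
Implicit Types (M : set H).
Variables (T : {linear H -> H}) (l : R[i]).
Hypothesis Tb : rbounded T.

Local Notation S := (sub_scalar T l).

Let Sb : rbounded S := rbounded_sub_scalar l Tb.

Let TE z : T z = S z + l *: z. Proof. by rewrite /sub_scalar subrK. Qed.

Lemma range_subspace : linear_subspace (range S).
Proof. exact: subspace_image. Qed.

Lemma range_mod z : range S (T z - l *: z). Proof. by exists z. Qed.

(** If [S m] is close to [S u] with [m] in the range, open mapping moves [u] slightly to some
    [u - w] with the same image as [m]. The two differ by a kernel element, so [u - w] is in the
    range, and [u] is a limit of such points. *)
Lemma nclosed_image_range : nclosed (range S) -> Defs.kernel S `<=` range S ->
  nclosed (S @` range S).
Proof.
move=> Mc kM; have Ms := range_subspace.
have [C C0 hC] := open_mapping Sb subspaceT nclosedT Mc.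
move=> v vN.
have [u _ uv] : range S v.
  by apply: Mc => e /vN[_ [m _ <-] vm]; exists (S m) => //; exists m.
exists u => //; apply: Mc => e e0.
have C1 : 0 < C + 1 by lra.
have [_ [m Mm <-] vm] := vN _ (divr_gt0 e0 C1).
have [|w [_ Sw wC]] := hC (S (u - m)); first by exists (u - m).
exists (u - w).
  rewrite -[u](subrK m) -addrA addrC -addrA; apply: subspaceD => //.
  rewrite addrC; apply: kM; rewrite /Defs.kernel /=.
  by rewrite linearB /= Sw subrr.
rewrite opprB addrC subrK (le_trans wC)// linearB /= uv.
rewrite -[leRHS](divfK (lt0r_neq0 C1)) mulrC.
by rewrite ler_pM// ?rnorm_ge0//; lra.
Qed.

(** Powers of a Jordan block: [q] stands for [n l^(n-1)]. The equation on [l * q] avoids the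
    predecessor of [n]; the clause for [n = 0] supplies what is needed when [l = 0]. *)
Lemma iter_mod_sqr M x n : linear_subspace M -> M (S (S x)) ->
  (forall z, M z -> M (S z)) ->
  exists q, [/\ M (iter n T x - (l ^+ n *: x + q *: S x)),
                l * q = n%:R * l ^+ n & n = 0 -> q = 0].
Proof.
move=> Ms MSS MS; elim: n => [|n [q [Mn qn _]]].
  exists 0; rewrite expr0 scale1r scale0r addr0 subrr mulr0 mul0r; split => //.
  exact: Ms.1.
exists (l ^+ n + l * q); split => //; last first.
  by rewrite mulrDr qn mulrCA -!exprS -natr1 mulrDl mul1r addrC.
have {Mn} [k Mn yE] : exists2 k, M k &
    iter n T x = k + (l ^+ n *: x + q *: S x).
  by exists (iter n T x - (l ^+ n *: x + q *: S x)); rewrite ?subrK.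
have -> : iter n.+1 T x - (l ^+ n.+1 *: x + (l ^+ n + l * q) *: S x) =
    S k + l *: k + q *: S (S x).
  have SE : S (k + (l ^+ n *: x + q *: S x)) =
      S k + (l ^+ n *: S x + q *: S (S x)).
    by rewrite linearD linearP linearZ.
  rewrite /= yE TE SE exprS scalerDl -!scalerA.
  move: (S k) (S x) (S (S x)) => w y z.
  apply/eqP; rewrite subr_eq; apply/eqP; rewrite !scalerDr !addrA.
  by rewrite [LHS](ACl (1*4*3*5*2*6)).
apply: subspaceD => //; last exact: subspaceZ.
by apply: subspaceD; [|exact: MS|exact: subspaceZ].
Qed.

(* Otherwise [S @` range S] is closed of codimension two and, modulo it, [T]
   acts on the span of [x] and [S x] as a Jordan block: the vectors
   [c (l^n, n l^(n-1))] stay away from [(1, b)] for a suitable [b]. *)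
Lemma supercyclic_kernel x : supercyclic_vector T x -> nclosed (range S) ->
  (exists z, ~ range S z) -> exists2 e, S e = 0 & ~ range S e.
Proof.
move=> xT Mc Mp; apply: contrapT => hn.
have kM : Defs.kernel S `<=` range S.
  by move=> e Se; apply: contrapT => nMe; apply: hn; exists e.
have Ms := range_subspace; have Ns := subspace_image S Ms.
have Nc := nclosed_image_range Mc kM.
have nMx := supercyclic_vector_notin xT Ms Mc range_mod Mp.
have nNSx : ~ (S @` range S) (S x).
  move=> [m Mm Smx]; apply: nMx; rewrite -(subrK m x); apply: subspaceD => //.
  by apply: kM; rewrite /Defs.kernel /= linearB /= Smx subrr.
have NM z : (S @` range S) z -> range S z by move=> [y _ <-]; exists y.
have [d d0 hd] := subspace_gap Ms Mc nMx.
have [d' d'0 hd'] := subspace_gap Ns Nc nNSx.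
have key b eta : 0 < eta -> exists c n q,
    [/\ rnorm (1 - c * l ^+ n) <= eta, rnorm (b - c * q) <= eta,
        l * q = n%:R * l ^+ n & n = 0 -> q = 0].
  move=> eta0.
  (* The second term leaves room for [(1 - c * l ^+ n) *: x], of norm at most [e / d * rnorm x],
     which is moved across before the gap of [S x] applies. *)
  pose e := Num.min (eta * d) (eta * d' / (1 + rnorm x / d)).
  have D0 : 0 < 1 + rnorm x / d by rewrite ltr_pwDl// divr_ge0 ?rnorm_ge0// ltW.
  have e0 : 0 < e by rewrite lt_min mulr_gt0//= divr_gt0// mulr_gt0.
  have e1 : e <= eta * d by rewrite ge_min lexx.
  have e2 : e * (1 + rnorm x / d) <= eta * d'.
    by rewrite -ler_pdivlMr// ge_min lexx orbT.
  have [c [n /ltW hc]] := xT (x + b *: S x) _ e0.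
  have [|||q [Nq lq q0]] := @iter_mod_sqr (S @` range S) x n.
  - exact: Ns.
  - by exists (S x) => //; exists x.
  - by move=> z /NM Mz; exists z.
  set k := iter n T x - _ in Nq.
  have wE : x + b *: S x - c *: iter n T x =
      (1 - c * l ^+ n) *: x + ((b - c * q) *: S x + (- c) *: k).
    rewrite -[iter n T x](subrK (l ^+ n *: x + q *: S x)) -/k.
    move: (S x) k {Nq} => y k; rewrite !scalerDr !opprD !scalerBl scale1r.
    rewrite !scalerA scaleNr !addrA.
    by rewrite [LHS](ACl (1*4*2*5*3)).
  rewrite wE in hc.
  exists c, n, q.
  have a1 : rnorm (1 - c * l ^+ n) * d <= e.
    apply: le_trans hc; apply: hd; apply: subspaceD => //.
      by apply: subspaceZ => //; exists x.
    by apply: subspaceZ => //; exact: NM.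
  split => //; first by rewrite -(ler_pM2r d0) (le_trans a1).
  rewrite -(ler_pM2r d'0) (le_trans _ e2)//.
  apply: le_trans (hd' _ (- c *: k) _) _; first exact: subspaceZ.
  have := rnormD ((1 - c * l ^+ n) *: x + ((b - c * q) *: S x + - c *: k))
    (- ((1 - c * l ^+ n) *: x)).
  rewrite rnormN addrAC subrr add0r rnormZ => h; apply: le_trans h _.
  rewrite mulrDr mulr1 lerD// mulrA mulrAC ler_wpM2r ?rnorm_ge0//.
  by rewrite ler_pdivlMr.
(* For [l = 0] the target [b = 1] fails: the first coefficient forces [n = 0], hence [q = 0]. *)
have [l0|l0] := eqVneq l 0.
  have [|c [n [q [h1 h2 _ h3]]]] := key 1 4^-1; first by rewrite invr_gt0.
  case: n h1 h3 => [|n]; last first.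
    by rewrite l0 expr0n /= mulr0 subr0 rnorm1 => h _; lra.
  by move=> _ /(_ erefl) q0; rewrite q0 mulr0 subr0 rnorm1 in h2; lra.
pose eta := (4 * (1 + rnorm l))^-1.
have L0 : 0 < 4 * (1 + rnorm l) by have := rnorm_ge0 l; lra.
have eta0 : 0 < eta by rewrite invr_gt0.
have eta1 : eta * (4 * (1 + rnorm l)) = 1 by rewrite mulVf// gt_eqF.
(* With [b = - l^-1], multiplying by [l] puts [n%:R * (c * l ^+ n)] near -1, while [c * l ^+ n],
   being near 1, has nonnegative real part. *)
have [c [n [q [h1 h2 lq _]]]] := key (- l^-1) eta eta0.
have h3 : rnorm (-1 - n%:R * (c * l ^+ n)) <= rnorm l * eta.
  have -> : -1 - n%:R * (c * l ^+ n) = l * (- l^-1 - c * q).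
    by rewrite mulrBr mulrN mulfV// [l * (c * q)]mulrCA lq mulrCA.
  by rewrite rnormM ler_wpM2l ?rnorm_ge0.
have h4 := ler_Re_rnorm (1 + n%:R * (c * l ^+ n)).
have h5 := ler_Re_rnorm (1 - c * l ^+ n).
rewrite raddfD /= in h4; rewrite raddfB /= in h5.
have h6 : complex.Re (n%:R * (c * l ^+ n)) = n%:R * complex.Re (c * l ^+ n).
  by rewrite mulr_natl raddfMn /= mulr_natl.
rewrite -opprD rnormN in h3.
have h7 : 0 <= n%:R * complex.Re (c * l ^+ n).
  by rewrite mulr_ge0//; have := rnorm_ge0 l; nra.
by have := rnorm_ge0 l; nra.
Qed.

End Kernel.

(** * Dimensions and spectra *)

Section Dimension.
Context {R : realType} {H : normedModType R[i]}.
Implicit Types (P : set nat) (S M : set H).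

Lemma einf_ge0 P : (0 <= einf P :> \bar R)%E.
Proof. by apply: le_ereal_inf_tmp => _ [n _ <-]; rewrite lee_fin. Qed.

Lemma einf_le P n : P n -> (einf P <= n%:R%:E :> \bar R)%E.
Proof. by move=> Pn; apply: ereal_inf_lbound; exists n. Qed.

Lemma einf_eq0 P : P 0%N -> einf P = 0%E :> \bar R.
Proof.
by move=> P0; apply/eqP; rewrite eq_le einf_ge0 andbT; exact: einf_le P0.
Qed.

Lemma einf_ge1 P : ~ P 0%N -> (1 <= einf P :> \bar R)%E.
Proof.
move=> P0; apply: le_ereal_inf_tmp => _ [[|n] Pn <-] //.
by rewrite lee_fin ler1n.
Qed.

Lemma einf_leP P n : (einf P <= n%:R%:E :> \bar R)%E ->
  exists2 m, P m & (m <= n)%N.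
Proof.
move=> Pn; have /ereal_inf_lt[_ [m Pm <-]] : (einf P < n.+1%:R%:E :> \bar R)%E.
  by rewrite (le_lt_trans Pn)// lte_fin ltr_nat.
by rewrite lte_fin ltr_nat ltnS => mn; exists m.
Qed.

Lemma einf_ltyP P : (einf P < +oo :> \bar R)%E -> exists m, P m.
Proof. by move=> /ereal_inf_lt[_ [m Pm _] _]; exists m. Qed.

Lemma edim_mod_eq0 S M : S `<=` M -> edim_mod S M = 0%E.
Proof.
move=> SM; apply: einf_eq0; exists (fun=> 0); split => [[]//|c _ []//|x Sx].
by exists (fun=> 0); rewrite big_ord0 subr0; exact: SM.
Qed.

Lemma edim_mod_le0 S M : (edim_mod S M <= 0)%E -> S `<=` M.
Proof.
move=> /(@einf_leP _ 0%N)[[|//] [v [_ _ h]] _] x /h[c].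
by rewrite big_ord0 subr0.
Qed.

Lemma edim_mod_ge1 S M : ~ (S `<=` M) -> (1 <= edim_mod S M)%E.
Proof.
move=> SM; apply: einf_ge1 => -[v [_ _ h]]; apply: SM => x /h[c].
by rewrite big_ord0 subr0.
Qed.

Lemma edim_mod_le1 S M e : S e -> (forall c, M (c *: e) -> c = 0) ->
  (forall x, S x -> exists c, M (x - c *: e)) -> (edim_mod S M <= 1)%E.
Proof.
move=> Se Me SM; apply: (@einf_le _ 1%N); exists (fun=> e); split => //.
  by move=> c; rewrite big_ord1 => /Me c0 i; rewrite (ord1 i).
by move=> x /SM[c Mc]; exists (fun=> c); rewrite big_ord1.
Qed.

Lemma edim_le1 S e : (edim S <= 1)%E -> S e -> e != 0 ->
  forall x, S x -> exists c, x = c *: e.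
Proof.
move=> /(@einf_leP _ 1%N)[[|[|//]] [v [_ _ h]] _] Se e0 x Sx.
  have [c] := h e Se; rewrite big_ord0 subr0 /= => e0'.
  by rewrite e0' eqxx in e0.
have [c] := h e Se; have [d] := h x Sx; rewrite !big_ord1 /=.
move=> /eqP; rewrite subr_eq0 => /eqP -> /eqP; rewrite subr_eq0 => /eqP eE.
exists (d ord0 / c ord0); rewrite [in RHS]eE scalerA divfK//.
by apply: contra_neq e0 => c0; rewrite eE c0 scale0r.
Qed.

End Dimension.

Section Spectra.
Context {R : realType} {H : completeNormedModType R[i]}.
Variable T : {linear H -> H}.
Hypothesis Tb : rbounded T.
Local Notation S := (sub_scalar T).

Lemma ker0_bounded_below l : (forall z, S l z = 0 -> z = 0) ->
  (forall z, range (S l) z) ->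
  exists2 C, 0 <= C & forall z, rnorm z <= C * rnorm (S l z).
Proof.
move=> ker0 surj; have Sb := rbounded_sub_scalar l Tb.
have [|C C0 hC] := open_mapping Sb subspaceT nclosedT.
  by move=> z _; exact: surj.
exists C => // z; have [|u [_ Su uC]] := hC (S l z); first by exists z.
suff <- : u = z by rewrite Su in uC *.
by apply/eqP; rewrite -subr_eq0; apply/eqP/ker0; rewrite linearB /= Su subrr.
Qed.

(** The bounded inverse theorem: the lower bound on [S l] is the bound on its inverse. *)
Lemma bijective_invertible l : (forall z, S l z = 0 -> z = 0) ->
  (forall z, range (S l) z) -> Defs.invertible (S l).
Proof.
move=> ker0 surj; have [C C0 hC] := ker0_bounded_below ker0 surj.
have /choice[g gP] : forall z, exists y, S l y = z.
  by move=> z; have [y _ <-] := surj z; exists y.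
have inj y z : S l y = S l z -> y = z.
  move=> yz; apply/eqP; rewrite -subr_eq0; apply/eqP/ker0.
  by rewrite linearB /= yz subrr.
have glin : linear g by move=> c y z; apply: inj; rewrite linearP /= !gP.
pose G : {linear H -> H} := HB.pack g (GRing.isLinear.Build _ _ _ _ g glin).
exists G; last by split => z; [apply: inj|]; exact: gP.
apply: rbounded_bounded_operator; exists C => // z.
by rewrite (le_trans (hC _))// gP.
Qed.

Lemma bijective_not_approx_spectrum l : (forall z, S l z = 0 -> z = 0) ->
  (forall z, range (S l) z) -> ~ approx_spectrum T l.
Proof.
move=> ker0 surj; have [C C0 hC] := ker0_bounded_below ker0 surj.
move=> [u u1 /cvgrPdist_lt] hu.
have C1 : 0 < C + 1 by lra.
have /hu[n _ /(_ n (leqnn n))] : 0 < ((C + 1)^-1)%:C%C :> R[i].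
  by rewrite ltcE /= eqxx invr_gt0.
rewrite /= sub0r normrN rnormE ltcR => h.
have h2 := hC (u n).
have : rnorm (u n) = 1 by apply: complexI; rewrite -rnormE u1.
have h3 : (C + 1)^-1 * (C + 1) = 1 by rewrite mulVf// gt_eqF.
by have := rnorm_ge0 (S l (u n)); nra.
Qed.

Lemma bijective_browder l : (forall z, S l z = 0 -> z = 0) ->
  (forall z, range (S l) z) -> browder (S l).
Proof.
move=> ker0 surj.
have rT : range (S l) = setT by apply/seteqP; split.
have k0 : Defs.kernel (S l) `<=` [set 0] by move=> z; exact: ker0.
have a0 : ascent (S l) = 0%E.
  apply: einf_eq0; apply/seteqP; split => z /=; rewrite /Defs.kernel /=.
    by move=> ->; rewrite linear0.
  exact: ker0.
have d0 : descent (S l) = 0%E.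
  by apply: einf_eq0; rewrite /= rT; apply/seteqP; split => // z _; exists z.
split; last by rewrite a0.
  by split; (split; [rewrite rT; exact: closedT|]);
    rewrite ?rT /edim /ecodim edim_mod_eq0.
by rewrite a0 d0.
Qed.

Lemma eigen_approx_spectrum l e : S l e = 0 -> e != 0 -> approx_spectrum T l.
Proof.
move=> Se e0; exists (fun=> (`|e|)^-1 *: e) => [_|].
  by rewrite normrZ normfV normr_id mulVf// normr_eq0.
by rewrite linearZ /= Se scaler0; exact: cvg_cst.
Qed.

(** A scalar exceeding twice a bound of [T] works, by a Neumann series. It provides [alpha] when
    [E T] is empty. *)
Lemma exists_browder_value : exists l, browder (S l).
Proof.
have [K K0 TK] := Tb; pose r := 2 * K + 1; exists r%:C%C.
have r0 : 0 < r by rewrite /r; lra.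
have rc0 : r%:C%C != 0 :> R[i] by rewrite eq_complex /= eqxx andbT gt_eqF.
have rn (z : H) : rnorm (r%:C%C *: z) = r * rnorm z.
  by rewrite rnormZ rnorm_real gtr0_norm.
apply: bijective_browder.
  move=> z /eqP; rewrite subr_eq0 => /eqP Tz; apply/eqP; rewrite -rnorm_eq0.
  have := TK z; rewrite Tz rn; have := rnorm_ge0 z; rewrite /r => z0 h.
  by rewrite eq_le z0 andbT; nra.
move=> z.
have [||u [_ Su _]] := @successive_approximation _ _ _ setT setT r^-1
    (rbounded_sub_scalar r%:C%C Tb) subspaceT nclosedT _ _ z I;
  last by exists u.
  by rewrite invr_ge0 ltW.
move=> v _; exists (- (r%:C%C^-1 *: v)); split => //.
  by rewrite rnormN rnormZ rnormV rnorm_real gtr0_norm.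
have -> : v - S r%:C%C (- (r%:C%C^-1 *: v)) = T (r%:C%C^-1 *: v).
  rewrite /sub_scalar scalerN opprK scalerA divff// scale1r linearN /=.
  by rewrite opprD opprK addrCA subrr addr0.
rewrite (le_trans (TK _))// rnormZ rnormV rnorm_real gtr0_norm//.
rewrite mulrA mulrC ler_wpM2l ?rnorm_ge0// ler_pdivrMr// /r.
by lra.
Qed.

End Spectra.

(** * A kernel line complementing a closed range *)

Section Split.
Context {R : realType} {H : completeNormedModType R[i]}.
Variables (T : {linear H -> H}) (l : R[i]).
Hypothesis Tb : rbounded T.
Local Notation S := (sub_scalar T l).

Let Ms : linear_subspace (range S) := range_subspace T l.

Lemma range_sub_iter : range S `<=` S @` range S ->
  forall n, range S `<=` range (iter n S).
Proof.
move=> SM; elim=> [|n ih] z Mz; first by exists z.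
by have [y My <-] := SM _ Mz; have [w _ <-] := ih _ My; exists w.
Qed.

(** Since the range is contained in that of every power, [z] is some [iter p S w]. Then [w] is in
    the kernel of the next power, hence in that of [iter p S]. *)
Lemma finite_ascent_kernel : range S `<=` S @` range S ->
  (ascent S < +oo)%E -> forall z, S z = 0 -> range S z -> z = 0.
Proof.
move=> SM /einf_ltyP[p hp] z Sz Mz.
have [w _ wz] := range_sub_iter SM p Mz.
suff : Defs.kernel (iter p S) w by rewrite /Defs.kernel /= wz.
by rewrite hp /Defs.kernel /= wz.
Qed.

Variable e : H.
Hypotheses (Se : S e = 0) (nMe : ~ range S e).
Hypothesis Me : forall z, exists t, range S (z - t *: e).

Lemma split_neq0 : e != 0.
Proof. by apply/eqP => e0; apply: nMe; rewrite e0; exact: Ms.1. Qed.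

Lemma split_range_image : range S `<=` S @` range S.
Proof.
move=> _ [z _ <-]; have [t Mt] := Me z; exists (z - t *: e) => //.
by rewrite linearB linearZ /= Se scaler0 subr0.
Qed.

Lemma split_scale_eq0 t : range S (t *: e) -> t = 0.
Proof.
move=> Mt; apply: contrapT => /eqP t0; apply: nMe.
by rewrite -(scalerK t0 e); exact: subspaceZ.
Qed.

Lemma split_kernel_line : (forall z, S z = 0 -> range S z -> z = 0) ->
  forall z, S z = 0 -> exists t, z = t *: e.
Proof.
move=> kM z Sz; have [t Mt] := Me z; exists t; apply/eqP; rewrite -subr_eq0.
apply/eqP/kM => //.
by rewrite linearB linearZ /= Sz Se scaler0 subr0.
Qed.

Lemma split_edim_gt0 : (0 < edim (Defs.kernel S))%E.
Proof.
rewrite ltNge; apply/negP => /edim_mod_le0/(_ e Se)/= e0.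
by have := split_neq0; rewrite e0 eqxx.
Qed.

Lemma split_ecodim : ecodim (range S) = 1%E.
Proof.
apply/eqP; rewrite eq_le; apply/andP; split.
  apply: (@edim_mod_le1 _ _ _ _ e) => //; exact: split_scale_eq0.
by apply: edim_mod_ge1 => h; apply: nMe; exact: h.
Qed.

Hypothesis ke : forall z, S z = 0 -> exists t, z = t *: e.

Lemma split_kernel_range z : S z = 0 -> range S z -> z = 0.
Proof. by move=> /ke[t ->] /split_scale_eq0 ->; rewrite scale0r. Qed.

Lemma split_edim : edim (Defs.kernel S) = 1%E.
Proof.
apply/eqP; rewrite eq_le; apply/andP; split.
  apply: (@edim_mod_le1 _ _ _ _ e) => //.
    by move=> c /= /eqP; rewrite scaler_eq0 (negbTE split_neq0) orbF => /eqP.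
  by move=> x /ke[t ->]; exists t; rewrite /= subrr.
apply: edim_mod_ge1 => /(_ e Se) /= e0.
by have := split_neq0; rewrite e0 eqxx.
Qed.

(** [S] is injective on its range and maps it onto itself, so kernels and ranges of the powers
    stabilise exactly from exponent 1 on. *)
Lemma split_browder : closed (range S) -> browder S.
Proof.
move=> Mc.
have ker n : Defs.kernel (iter n.+1 S) = Defs.kernel S.
  elim: n => [//|n ih]; apply/seteqP; split => z; last first.
    by rewrite -ih /Defs.kernel /= => ->; rewrite linear0.
  by move=> Sz; rewrite -ih; apply: split_kernel_range.
have ran n : range (iter n.+1 S) = range S.
  apply/seteqP; split => [_ [z _ <-]|]; first by exists (iter n S z).
  exact/range_sub_iter/split_range_image.
have a1 n : Defs.kernel (iter n S) = Defs.kernel (iter n.+1 S) <-> (0 < n)%N.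
  split; case: n => [|n] //; last by rewrite !ker.
  move=> h; have : Defs.kernel (iter 0 S) e by rewrite h.
  by rewrite /Defs.kernel /= => e0; have := split_neq0; rewrite e0 eqxx.
have d1 n : range (iter n S) = range (iter n.+1 S) <-> (0 < n)%N.
  split; case: n => [|n] //; last by rewrite !ran.
  by move=> h; case: nMe; rewrite -(ran 0%N) -h; exists e.
split.
- by split; split => //; rewrite ?split_edim ?split_ecodim ltry.
- by congr einf; apply/seteqP; split => n /=; rewrite a1 d1.
- by apply: (@le_lt_trans _ _ (1%:R%:E)); [exact/einf_le/a1|rewrite ltry].
Qed.

(** On the range, [S] is invertible and survives a small perturbation; on the line of [e], the
    perturbed operator is multiplication by the nonzero scalar [- dl]. *)
Lemma split_invertible : nclosed (range S) -> exists2 r : R, 0 < r &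
  forall mu, mu != l -> rnorm (mu - l) <= r ->
    Defs.invertible (sub_scalar T mu).
Proof.
move=> Mc; have Sb := rbounded_sub_scalar l Tb.
have SMc : nclosed (S @` range S).
  suff -> : S @` range S = range S by [].
  apply/seteqP; split; last exact: split_range_image.
  by move=> _ [z _ <-]; exists z.
have [C C0 hC] := open_mapping Sb Ms Mc SMc.
have C1 : 0 < 2 * (C + 1) by lra.
(* This radius gives [rnorm dl * C <= 1 / 2], the contraction needed for injectivity and for
   successive approximation. *)
exists (2 * (C + 1))^-1; first by rewrite invr_gt0.
move=> mu; rewrite -subr_eq0; set dl := mu - l => dl0 dlr.
have {dlr} dlC x y : 0 <= y -> x <= C * y -> rnorm dl * x <= y / 2.
  move=> y0 xy; have := rnorm_ge0 dl; move: dlr.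
  rewrite -[_^-1]div1r ler_pdivlMr// => h1 h2.
  have := ler_wpM2l h2 xy; nra.
have muE z : sub_scalar T mu z = S z - dl *: z.
  by rewrite /sub_scalar /dl scalerBl opprB addrA subrK.
apply: bijective_invertible => //.
  move=> z; rewrite muE => /eqP; rewrite subr_eq0 => /eqP Sz.
  have Mz : range S z.
    by rewrite -(scalerK dl0 z) -Sz; apply: subspaceZ => //; exists z.
  have [|u [Mu Su uC]] := hC (S z); first by exists z.
  have uz : u = z.
    apply/eqP; rewrite -subr_eq0; apply/eqP/split_kernel_range.
      by rewrite linearB /= Su subrr.
    exact: subspaceB.
  have := dlC _ _ (rnorm_ge0 _) uC; rewrite uz Sz rnormZ => h.
  have : dl *: z = 0.
    apply/eqP; rewrite -rnorm_eq0 rnormZ eq_le mulr_ge0 ?rnorm_ge0// andbT.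
    by lra.
  by move/eqP; rewrite scaler_eq0 (negbTE dl0) /= => /eqP.
move=> z; have [t Mt] := Me z.
have [|u [_ Su _]] := successive_approximation (rbounded_sub_scalar mu Tb)
  Ms Mc C0 _ Mt.
  move=> v Mv; have [u [Mu Su uC]] := hC v (split_range_image Mv).
  exists u; split => //; rewrite /= muE Su opprB addrC subrK.
    exact: (subspaceZ _ Ms Mu).
  by rewrite rnormZ dlC ?rnorm_ge0.
(* [u] solves the component in the range; the multiple of [e] produces the remaining [t *: e]. *)
exists (u - (dl^-1 * t) *: e) => //.
have Smue : sub_scalar T mu e = - (dl *: e) by rewrite muE Se sub0r.
rewrite linearB linearZ /= Su Smue scalerN scalerA mulrAC mulVf// mul1r.
by rewrite opprK subrK.
Qed.

Lemma split_E : nclosed (range S) -> E T l.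
Proof.
move=> Mc; split; last exact: split_edim_gt0.
have sl : spectrum T l.
  move=> [G _ [GS _]]; have e0 : e = 0 by rewrite -(GS e) Se linear0.
  by have := split_neq0; rewrite e0 eqxx.
split; first exact/mem_set.
have [r r0 hr] := split_invertible Mc.
have rc0 : 0 < r%:C%C :> R[i] by rewrite ltcE /= eqxx.
exists (ball (l : R[i]^o) r%:C%C); first exact: nbhsx_ballx.
apply/seteqP; split => [mu [+ smu]|_ ->]; last first.
  by split => //; exact: ballxx.
rewrite -ball_normE /ball_ /= rnormE ltcR rdistC => /ltW mur.
by apply: contrapT => /eqP nmu; apply: smu; exact: hr.
Qed.

End Split.

(** * Property (UW_E) *)

Section Main.
Context {R : realType} {H : completeNormedModType R[i]}.
Variable T : {linear H -> H}.
Hypothesis Tb : rbounded T.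
Local Notation S := (sub_scalar T).

Lemma semi_fredholm_closed l : semi_fredholm (S l) -> closed (range (S l)).
Proof. by move=> [[]|[]]. Qed.

(** Were [S l] onto, the index condition would make it injective too, hence bounded below, which
    excludes an approximate eigenvalue. *)
Lemma approx_semi_weyl_range l :
  (approx_spectrum T `\` upper_semi_weyl_spectrum T) l ->
  [/\ closed (range (S l)), exists z, ~ range (S l) z &
      (edim (Defs.kernel (S l)) <= ecodim (range (S l)))%E].
Proof.
move=> [al /contrapT[/semi_fredholm_closed Mc]].
rewrite /fredholm_index sube_le0 => kc; split => //.
apply/existsNP => surj; apply: bijective_not_approx_spectrum al => // z Sz.
move: kc; rewrite [X in (_ <= X)%E]edim_mod_eq0; last first.
  by move=> x _; exact: surj.
by move/edim_mod_le0; exact.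
Qed.

Lemma hypercyclic_approx_semi_weyl : hypercyclic T ->
  approx_spectrum T `\` upper_semi_weyl_spectrum T = set0.
Proof.
move=> hT; rewrite -subset0 => l /approx_semi_weyl_range[Mc [z nMz] _].
apply: nMz; apply: (hypercyclic_dense_range hT (range_subspace T l)).
  exact: closed_nclosed.
exact: range_mod.
Qed.

Variable x : H.
Hypothesis xT : supercyclic_vector T x.

(** The range has the complement spanned by [x]; a kernel vector outside the range has a nonzero
    coefficient on [x] and can replace it. *)
Lemma supercyclic_split l : nclosed (range (S l)) ->
  (exists z, ~ range (S l) z) ->
  exists e, [/\ S l e = 0, ~ range (S l) e &
                forall z, exists t, range (S l) (z - t *: e)].
Proof.
move=> Mc Mp; have Ms := range_subspace T l.
have hM := range_mod T l.
have nMx := supercyclic_vector_notin xT Ms Mc hM Mp.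
have codim1 := supercyclic_codim1 xT Ms Mc hM nMx.
have [e Se nMe] := supercyclic_kernel Tb xT Mc Mp.
exists e; split => // z; have [a Ma] := codim1 e; have [c Mc'] := codim1 z.
have a0 : a != 0.
  by apply/eqP => a0; apply: nMe; rewrite a0 scale0r subr0 in Ma.
exists (c / a).
have -> : z - (c / a) *: e = (z - c *: x) - (c / a) *: (e - a *: x).
  by rewrite scalerBr scalerA divfK// opprB addrA subrK.
by apply: subspaceB => //; exact: subspaceZ.
Qed.

(** The range has codimension 1, so the index condition leaves only the line of [e] for the
    kernel. *)
Lemma supercyclic_approx_semi_weyl l :
  (approx_spectrum T `\` upper_semi_weyl_spectrum T) l ->
  [/\ E T l, browder (S l), nclosed (range (S l)) & exists z, ~ range (S l) z].
Proof.
move=> /approx_semi_weyl_range[Mc Mp kc]; have Mnc := closed_nclosed Mc.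
have [e [Se nMe Me]] := supercyclic_split Mnc Mp.
have ke z : S l z = 0 -> exists t, z = t *: e.
  move=> Sz; apply: (@edim_le1 _ _ (Defs.kernel (S l))) => //.
    by rewrite (le_trans kc)// (split_ecodim nMe Me).
  exact: split_neq0 nMe.
split => //; first exact: (split_E Tb Se nMe Me ke).
exact: (split_browder Se nMe Me ke).
Qed.

(** Finite ascent does double duty: it excludes an onto [S l] with a nonzero kernel, and then it
    reduces the kernel to a line, whence index 0. *)
Lemma browder_eigenvalue_approx_semi_weyl l : browder (S l) -> E T l ->
  (approx_spectrum T `\` upper_semi_weyl_spectrum T) l.
Proof.
move=> [fS aS afin] [_ k0]; have Mc := semi_fredholm_closed (or_introl fS.1).
have [e0 Se0 e00] : exists2 e0, S l e0 = 0 & e0 != 0.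
  apply: contrapT => hn; move: k0; rewrite /edim edim_mod_eq0 ?ltxx// => z Sz.
  by apply: contrapT => z0; apply: hn; exists z => //; exact/eqP.
have Mp : exists z, ~ range (S l) z.
  apply/existsNP => surj.
  have SM : range (S l) `<=` S l @` range (S l) by move=> _ [z _ <-]; exists z.
  have := finite_ascent_kernel SM afin Se0 (surj e0).
  by move/eqP; rewrite (negbTE e00).
have [e [Se nMe Me]] := supercyclic_split (closed_nclosed Mc) Mp.
have ke := split_kernel_line Se Me
  (finite_ascent_kernel (split_range_image Se Me) afin).
split; first exact: eigen_approx_spectrum Se0 e00.
move=> /(_ _); apply; split; first by left; exact: fS.1.
rewrite /fredholm_index sube_le0 (split_ecodim nMe Me).
by rewrite (split_edim Se nMe ke).
Qed.

Lemma supercyclic_UWE : property_UWE T <->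
  exists2 alpha : R[i], ~ browder_spectrum T alpha & E T `<=` [set alpha].
Proof.
split => [UWE|[a /contrapT ba Ea]]; last first.
  apply/seteqP; split => l.
    by move=> /supercyclic_approx_semi_weyl[].
  move=> El; have /= la := Ea _ El.
  by apply: browder_eigenvalue_approx_semi_weyl => //; rewrite la.
have [[l El]|nE] := pselect (exists l, E T l); last first.
  have [l bl] := exists_browder_value Tb; exists l; first by move=> /(_ bl).
  by move=> m Em; case: nE; exists m.
(* Under the property, each point of [E T] has a proper closed range; two distinct such points would
   contradict [supercyclic_deficient_unique]. *)
have Eprop m : E T m -> _ := fun Em => supercyclic_approx_semi_weyl
  (eq_ind_r (fun A : set R[i] => A m) Em UWE).
have [_ bl lc lp] := Eprop l El.
exists l; first by move=> /(_ bl).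
move=> m Em; apply: contrapT => /eqP ml; have [_ _ mc mp] := Eprop m Em.
apply: (supercyclic_deficient_unique xT ml (range_subspace T m) mc
  (range_mod T m) (range_subspace T l) lc (range_mod T l)).
- exact: (supercyclic_vector_notin xT (range_subspace T m) mc (range_mod T m)).
- exact: (supercyclic_vector_notin xT (range_subspace T l) lc (range_mod T l)).
Qed.

End Main.

Theorem theorem3p1 (R : realType) (H : completeNormedModType R[i])
    (dot : {dot H for Num.conj})
    (dot_norm : forall x : H, dot x x = `|x| ^+ 2)
    (H_separable : separable_space H)
    (H_infinite : edim [set: H] = +oo%E)
    (T : {linear H -> H}) (T_bounded : bounded_operator T) :
  (hypercyclic T -> (property_UWE T <-> E T = set0)) /\
  (supercyclic T -> E T `<=` E0 (adjoint dot T) ->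
    (property_UWE T <->
     exists2 alpha : R[i], ~ browder_spectrum T alpha & E T `<=` [set alpha])).
Proof.
have Tb := bounded_operator_rbounded T_bounded.
split => [hT|/supercyclicP[x xT] _]; last exact: supercyclic_UWE Tb x xT.
by rewrite /property_UWE (hypercyclic_approx_semi_weyl Tb hT); split.
Qed.
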